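(* Let $n \geqslant 2$, let $A \in M_n(\mathbb{C})$ be nonsingular with singular values $\sigma_1 \geqslant \sigma_2 \geqslant \cdots \geqslant \sigma_n > 0$, let $a_1$ be a real number with $a_1 \geqslant \sigma_1$, and define $$a_{k+1}=\left(a_k^2-\left|\det\left(a_k^2 I_n-A^{H}A\right)\right|\left(\frac{n-1}{(n+1)a_k^2-\|A\|_F^2}\right)^{n-1}\right)^{1/2},\quad k=1,2,\dots.$$ Then $\sigma_1 \leqslant a_{k+1} \leqslant a_k$ for all $k=1,2,\dots$, and $\lim_{k\to+\infty} a_k=\sigma_1$.
   Context: $M_n(\mathbb{C})$ is the space of $n\times n$ complex matrices, $A^{H}$ is the conjugate transpose of $A$, $I_n$ is the $n \times n$ identity matrix, and $\|A\|_F=\left(\sum_{i,j=1}^n |a_{ij}|^2\right)^{1/2}$ is the Frobenius norm of $A=[a_{ij}]$. Singular values are listed in decreasing order with multiplicity. *)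

(* Defs.v *)
From HB Require Import structures.
From mathcomp Require Import all_boot all_order all_algebra.
From mathcomp Require Import complex.
From mathcomp Require Import all_classical all_reals.
From mathcomp Require Import topology normedtype sequences.
Export numFieldNormedType.Exports.

Set Implicit Arguments.
Unset Strict Implicit.
Unset Printing Implicit Defensive.

Import Order.TTheory GRing.Theory Num.Theory.
Local Open Scope ring_scope.
Local Open Scope sesquilinear_scope.

(* The norm of R[i] takes its values in R[i]; this is the same norm in R. *)
Definition modulus (R : realType) (z : R[i]) : R := complex.Re `|z|.

Definition frobenius_norm (R : realType) (n : nat) (A : 'M[R[i]]_n) : R :=
  Num.sqrt (\sum_(i < n) \sum_(j < n) modulus (A i j) ^+ 2).

(* The n roots of the characteristic polynomial, repeated according to their
   algebraic multiplicity, in an unspecified order. *)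
Definition eigenvalues (R : realType) (n : nat) (M : 'M[R[i]]_n) : seq R[i] :=
  sval (closed_field_poly_normal (char_poly M)).

(* The eigenvalues of A^t* *m A are real and nonnegative, so that taking their
   real parts loses nothing. *)
Definition singular_values (R : realType) (n : nat) (A : 'M[R[i]]_n) : seq R :=
  sort >=%R
    [seq Num.sqrt (complex.Re z) | z <- eigenvalues (A^t* *m A)].

(* Main.v *)
(** Let l be the largest eigenvalue of A^H A, t the list of the m = n - 1 others
    and x = a_k^2 >= l.  The decrement x - a_{k+1}^2 is
      (x - l) * prod_{y in t} (x - y) * (m / D)^m,   D = (n+1) x - ||A||_F^2.
    Since ||A||_F^2 = l + sum t, the sum of the factors x - y is at most D, so by
    AM-GM the decrement is at most x - l, hence a_{k+1}^2 >= l.  It is also at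
    least c (x - l)^n with c > 0 independent of k, because D <= (n+1) a_1^2; as
    a_k decreases to some limit L, the decrements tend to 0 and L^2 = l. *)
Require Import Defs.
From HB Require Import structures.
From mathcomp Require Import all_boot all_order all_algebra.
From mathcomp Require Import complex.
From mathcomp Require Import all_classical all_reals.
From mathcomp Require Import topology normedtype sequences.
From mathcomp Require Import lra.
Import numFieldNormedType.Exports.
Import Order.TTheory GRing.Theory Num.Theory.
Local Open Scope ring_scope.
Local Open Scope complex_scope.
Local Open Scope sesquilinear_scope.
Local Open Scope classical_set_scope.

(** * Spectrum of the Gram matrix $A^H A$ *)

Lemma mul_conj_trmx (C : numClosedFieldType) (m n : nat) (B : 'M[C]_(m, n)) i :
  (B *m B^t*) i i = \sum_j `|B i j| ^+ 2.
Proof. by rewrite mxE; apply: eq_bigr => j _; rewrite !mxE normCK. Qed.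

Lemma row_mul_conj_trmx_gt0 (C : numClosedFieldType) (n : nat) (v : 'rV[C]_n) :
  v != 0 -> 0 < (v *m v^t*) 0 0.
Proof.
move=> vN0; rewrite mul_conj_trmx lt_def sumr_ge0 ?andbT; last first.
  by move=> j _; rewrite exprn_ge0.
apply: contraNneq vN0 => /eqP.
rewrite psumr_eq0 => [/allP v0|j _]; last by rewrite exprn_ge0.
apply/eqP/rowP => j; rewrite mxE.
by have := v0 j (mem_index_enum j); rewrite expf_eq0 normr_eq0 /= => /eqP.
Qed.

(** For a row eigenvector [v], the vector [w] $= v A^H$ satisfies $w w^H = z\, v v^H$. Both squared
    norms are positive because $A^H$ is invertible, which forces [z] to be positive. *)
Lemma eigenvalue_gram_gt0 (C : numClosedFieldType) (n : nat) (A : 'M[C]_n) z :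
  A \in unitmx -> eigenvalue (A^t* *m A) z -> 0 < z.
Proof.
move=> Au /eigenvalueP[v vM vN0].
pose w := v *m A^t*.
have wE : w *m w^t* = z *: (v *m v^t*).
  have AK : (A^t*)^t* = A by apply/matrixP => i j; rewrite !mxE conjCK.
  rewrite {2}/w trmx_mul map_mxM AK.
  by rewrite mulmxA /w -(mulmxA v) vM scalemxAl.
have wN0 : w != 0.
  have Bu : A^t* \in unitmx by rewrite map_unitmx unitmx_tr.
  by apply: contraNneq vN0 => w0; rewrite -(mulmxK Bu v) -/w w0 mul0mx.
have := row_mul_conj_trmx_gt0 _ _ _ wN0.
by rewrite wE mxE pmulr_lgt0 // row_mul_conj_trmx_gt0.
Qed.

Lemma horner_char_poly (C : comNzRingType) (n : nat) (M : 'M[C]_n) x :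
  (char_poly M).[x] = \det (x%:M - M).
Proof.
rewrite -horner_evalE -det_map_mx; congr (\det _); apply/matrixP => i j.
by rewrite !mxE /= /horner_eval hornerD hornerN hornerMn hornerX hornerC.
Qed.

Lemma sqr_frobenius_norm (R : realType) (n : nat) (A : 'M[R[i]]_n) :
  (frobenius_norm A ^+ 2)%:C = \tr (A^t* *m A).
Proof.
rewrite sqr_sqrtr; last by do 2!apply: sumr_ge0 => ? _; exact: sqr_ge0.
rewrite mxtrace_mulC /mxtrace rmorph_sum; apply: eq_bigr => i _.
rewrite mul_conj_trmx rmorph_sum; apply: eq_bigr => j _.
by rewrite rmorphXn /= /modulus RRe_real ?normr_real.
Qed.

Lemma char_poly_eigenvalues (R : realType) (n : nat) (M : 'M[R[i]]_n) :
  char_poly M = \prod_(z <- eigenvalues M) ('X - z%:P).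
Proof.
rewrite /eigenvalues; case: closed_field_poly_normal => /= s.
by rewrite (eqP (char_poly_monic M)) scale1r.
Qed.

Lemma size_eigenvalues (R : realType) (n : nat) (M : 'M[R[i]]_n) :
  size (eigenvalues M) = n.
Proof.
have := size_char_poly M.
by rewrite char_poly_eigenvalues size_prod_XsubC => -[].
Qed.

(** Since the spectrum is positive, the problem reduces to one real list [s]: singular values,
    determinant and Frobenius norm are all read off the factored characteristic polynomial. *)
Lemma gram_spectrum (R : realType) (n : nat) (A : 'M[R[i]]_n) :
    (0 < n)%N -> A \in unitmx ->
  exists s : seq R,
    [/\ size s = n, all (> 0) s,
        singular_values A = sort >=%R (map Num.sqrt s),
        forall x, \det (x%:C%:M - A^t* *m A) = (\prod_(y <- s) (x - y))%:C
      & frobenius_norm A ^+ 2 = \sum_(y <- s) y].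
Proof.
move=> n0 Au; set M := A^t* *m A; set e := eigenvalues M.
have e_gt0 z : z \in e -> 0 < z.
  move=> ze; apply: (eigenvalue_gram_gt0 _ _ _ _ Au).
  by rewrite eigenvalue_root_char char_poly_eigenvalues root_prod_XsubC.
have eE z : z \in e -> (complex.Re z)%:C = z.
  by move=> /e_gt0 z0; rewrite RRe_real ?gtr0_real.
exists [seq complex.Re z | z <- e]; split.
- by rewrite size_map size_eigenvalues.
- by apply/allP => _ /mapP[z /[dup] ze /e_gt0 z0 ->]; rewrite -ltcR eE.
- by rewrite -map_comp.
- move=> x; rewrite -horner_char_poly char_poly_eigenvalues horner_prod.
  rewrite big_map rmorph_prod; apply: eq_big_seq => z ze.
  by rewrite !hornerE rmorphB /= eE.
- apply: complexI; rewrite sqr_frobenius_norm -/M big_map rmorph_sum /=.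
  (* The trace is minus the subleading coefficient of the characteristic polynomial, hence the sum
     of its roots. *)
  rewrite (eq_big_seq _ eE) -[LHS]opprK -char_poly_trace // -{2}(size_eigenvalues R n M).
  by rewrite char_poly_eigenvalues coefPn_prod_XsubC ?opprK // size_eigenvalues -lt0n.
Qed.

Lemma head_sort_ge_map_sqrt (R : realType) (s : seq R) :
    (0 < size s)%N -> all (> 0) s ->
  exists l, [/\ (sort >=%R (map Num.sqrt s))`_0 = Num.sqrt l, l \in s
              & all (<= l) s].
Proof.
move=> s0 /allP s_gt0; set u := sort _ _.
have u0 : (0 < size u)%N by rewrite size_sort size_map.
have : u`_0 \in u by exact: mem_nth.
rewrite mem_sort => /mapP[l ls uE]; exists l; split => //.
apply/allP => y ys /=.
have : Num.sqrt y \in u by rewrite mem_sort map_f.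
have : sorted >=%R u by apply: sort_sorted => a b; exact: le_total.
rewrite -ler_sqrt ?(ltW (s_gt0 l ls)) // -uE; case: (u) u0 => //= h t _ ht.
rewrite inE => /predU1P[->//|yt].
by have /allP := order_path_min ge_trans ht; apply.
Qed.

(** * Bounds on one decrement *)

Lemma prod_le_mean_exp (F : numFieldType) (s : seq F) :
  all (>= 0) s -> \prod_(y <- s) y <= ((\sum_(y <- s) y) / (size s)%:R) ^+ size s.
Proof.
move=> /allP s0; rewrite (big_nth 0) [X in X / _](big_nth 0) !big_mkord.
have /= [] := leif_AGM (A := predT) (E := fun i : 'I_(size s) => s`_i); last first.
  by rewrite card_ord.
by move=> i _; rewrite s0 ?mem_nth.
Qed.

Section Decrement.
Variables (R : realFieldType) (l x : R) (t : seq R).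
Hypotheses (l0 : 0 < l) (lx : l <= x).
Hypotheses (t_gt0 : all (> 0) t) (t_le : all (<= l) t).
Let m := size t.
(** The denominator of the recurrence: with $n = m+1$, the factor $n+1$ is [m.+2], and the
    subtracted sum is $\|A\|_F^2$. *)
Let D := m.+2%:R * x - (l + \sum_(y <- t) y).

Let sum_t_le : \sum_(y <- t) y <= m%:R * x.
Proof.
have -> : m%:R * x = \sum_(i < m) x by rewrite sumr_const card_ord mulr_natl.
rewrite (big_nth 0) big_mkord.
apply: ler_sum => i _; apply: le_trans lx.
by apply: (allP t_le); rewrite mem_nth.
Qed.

Let sum_t_ge0 : 0 <= \sum_(y <- t) y.
Proof. by rewrite big_seq sumr_ge0 // => y /(allP t_gt0)/ltW. Qed.

Let x_gt0 : 0 < x. Proof. exact: lt_le_trans lx. Qed.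

Let D_gt0 : 0 < D.
Proof. by rewrite /D -[m.+2]addn2 natrD mulrDl; move: sum_t_le lx x_gt0; lra. Qed.

Lemma decrement_le :
  (x - l) * \prod_(y <- t) (x - y) * (m%:R / D) ^+ m <= x - l.
Proof.
have gap_ge0 : 0 <= x - l by rewrite subr_ge0.
rewrite -mulrA -[leRHS]mulr1 ler_wpM2l //.
have t'0 : all (>= 0) [seq x - y | y <- t].
  by apply/allP => _ /mapP[y /(allP t_le) yl ->]; rewrite subr_ge0 (le_trans yl).
have := prod_le_mean_exp _ _ t'0; rewrite !big_map size_map -/m => AGM.
have q0 : 0 <= m%:R / D by rewrite divr_ge0 // ltW.
apply: (le_trans (ler_wpM2r _ AGM)); first by rewrite exprn_ge0.
rewrite -exprMn sumrB big_const_seq count_predT iter_addr_0 -/m.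
(* The factor [m] cancels the division in the arithmetic mean only when it is nonzero; otherwise the
   power is trivial. *)
have [->|mN0] := eqVneq m 0; first by rewrite expr0.
rewrite mulrA divfK ?pnatr_eq0 //.
have num_ge0 : 0 <= m%:R * x - \sum_(y <- t) y by rewrite subr_ge0.
rewrite -mulr_natl exprn_ile1 ?(divr_ge0 num_ge0 (ltW D_gt0)) //.
(* The mean times [m%:R / D] has become $(mx - \sum t)/D$, and the denominator exceeds the numerator
   by $2x - l \geq 0$. *)
rewrite ler_pdivrMr // mul1r /D -[m.+2]addn2 natrD mulrDl.
by move: lx x_gt0; lra.
Qed.

(** Each [x - y] is at least [x - l], and [D] is at most [m.+2%:R * b] because the subtracted sum is
    nonnegative. One [b] serves all iterates, so the bound is uniform in $k$. *)
Lemma decrement_ge (b : R) : x <= b ->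
  (x - l) ^+ m.+1 * (m%:R / (m.+2%:R * b)) ^+ m
    <= (x - l) * \prod_(y <- t) (x - y) * (m%:R / D) ^+ m.
Proof.
move=> xb; have b0 : 0 < b by exact: lt_le_trans xb.
have gap_ge0 : 0 <= x - l by rewrite subr_ge0.
have mb0 : 0 < m.+2%:R * b by rewrite mulr_gt0.
apply: ler_pM.
- by rewrite exprn_ge0.
- by rewrite exprn_ge0 // divr_ge0 // ltW.
- rewrite exprS ler_wpM2l // (big_nth 0) big_mkord -/m.
  have -> : (x - l) ^+ m = \prod_(i < m) (x - l) by rewrite prodr_const card_ord.
  apply: ler_prod => i _; rewrite gap_ge0 lerD2l lerN2.
  by apply: (allP t_le); rewrite mem_nth.
- rewrite lerXn2r ?nnegrE ?divr_ge0 ?(ltW D_gt0) ?(ltW mb0) //.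
  rewrite ler_wpM2l // lef_pV2 ?posrE // /D.
  have : m.+2%:R * x <= m.+2%:R * b by rewrite ler_wpM2l.
  by move: l0 sum_t_ge0; lra.
Qed.

End Decrement.

(** * Monotonicity and convergence of the iteration *)

Theorem theorem2 (R : realType) (n : nat) (A : 'M[R[i]]_n) (a : nat -> R)
    (sigma1 := (singular_values A)`_0) :
  (2 <= n)%N ->
  A \in unitmx ->
  sigma1 <= a 1%N ->
  (forall k : nat, (1 <= k)%N ->
    a k.+1 =
      Num.sqrt (a k ^+ 2 -
        modulus (\det ((a k ^+ 2)%:C%:M - A^t* *m A)) *
        ((n%:R - 1) / ((n%:R + 1) * a k ^+ 2 - frobenius_norm A ^+ 2))
          ^+ (n - 1))) ->
  (forall k : nat, (1 <= k)%N -> sigma1 <= a k.+1 /\ a k.+1 <= a k) /\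
  a @ \oo --> sigma1.
Proof.
move=> n2 Au sigma1_le aS.
have n_gt0 : (0 < n)%N by exact: ltnW.
have [s [sz s_gt0 svE detE frobE]] := gram_spectrum R n A n_gt0 Au.
have sz_gt0 : (0 < size s)%N by rewrite sz.
have [l [sigmaE ls s_le]] := head_sort_ge_map_sqrt R s sz_gt0 s_gt0.
have l0 : 0 < l by exact: (allP s_gt0).
have {svE} {}sigmaE : sigma1 = Num.sqrt l by rewrite /sigma1 svE.
(* Only one copy of [l] is removed, so a multiple largest eigenvalue still occurs in [t]. *)
set t := rem l s; set m := size t.
have st : perm_eq s (l :: t) by exact: perm_to_rem.
have nE : n = m.+1 by rewrite -sz (perm_size st).
have m_gt0 : (0 < m)%N by rewrite -ltnS -nE.
have t_gt0 : all (> 0) t.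
  by move: s_gt0; rewrite (perm_all _ st) => /andP[].
have t_le : all (<= l) t.
  by move: s_le; rewrite (perm_all _ st) => /andP[].
pose dec x := (x - l) * \prod_(y <- t) (x - y) *
  (m%:R / (m.+2%:R * x - (l + \sum_(y <- t) y))) ^+ m.
(* For $x \geq l$ every factor [x - y] is nonnegative, so the modulus of the determinant is the
   product itself. *)
have aSE k : (1 <= k)%N -> l <= a k ^+ 2 ->
    a k.+1 = Num.sqrt (a k ^+ 2 - dec (a k ^+ 2)).
  move=> k1 lk; rewrite aS // detE frobE !(perm_big _ st) !big_cons /modulus.
  rewrite normc_def /= expr0n /= addr0 sqrtr_sqr ger0_norm; last first.
    rewrite mulr_ge0 ?subr_ge0 // big_seq prodr_ge0 // => y /(allP t_le) yl.
    by rewrite subr_ge0 (le_trans yl).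
  have -> : n%:R - 1 = m%:R :> R by rewrite nE -natr1 addrK.
  by rewrite natr1 nE subn1.
have sigma_gt0 : 0 < sigma1 by rewrite sigmaE sqrtr_gt0.
have sqr_sigma : sigma1 ^+ 2 = l by rewrite sigmaE sqr_sqrtr // ltW.
have l_le x : sigma1 <= x -> l <= x ^+ 2.
  by move=> ?; rewrite -sqr_sigma lerXn2r ?nnegrE ?(le_trans (ltW sigma_gt0)).
have dec_ge0 x : l <= x -> 0 <= dec x.
  (* The lower bound is taken with [b := x]. *)
  move=> lx; apply: le_trans (decrement_ge _ _ _ _ l0 lx t_gt0 t_le x (lexx _)).
  rewrite mulr_ge0 // exprn_ge0 ?subr_ge0 // divr_ge0 // mulr_ge0 //.
  exact: le_trans (ltW l0) lx.
have step k : (1 <= k)%N -> sigma1 <= a k ->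
    [/\ sigma1 <= a k.+1, a k.+1 <= a k & a k.+1 ^+ 2 = a k ^+ 2 - dec (a k ^+ 2)].
  move=> k1 sk; have lk := l_le _ sk.
  have decle := decrement_le _ _ _ _ l0 lk t_le.
  (* Besides giving $\sigma_1 \leq a_{k+1}$, this keeps the radicand nonnegative, so squaring undoes
     [Num.sqrt], which is 0 on negative reals. *)
  have nx : l <= a k ^+ 2 - dec (a k ^+ 2).
    by rewrite lerBrDr -lerBrDl.
  have ak0 : 0 <= a k by exact: le_trans (ltW sigma_gt0) sk.
  rewrite aSE // sigmaE; split.
  - by rewrite ler_wsqrtr.
  - rewrite -[leRHS]ger0_norm // -sqrtr_sqr ler_wsqrtr // gerBl.
    exact: dec_ge0.
  - by rewrite sqr_sqrtr // (le_trans (ltW l0)).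
have sigma_le k : sigma1 <= a k.+1.
  by elim: k => // k IH; have [] := step k.+1 isT IH.
split=> [k k1|].
  by case: k k1 => // k _; have [] := step k.+1 isT (sigma_le k).
(* The value [a 0] is unconstrained, so the sequence is shifted to start at [a 1]. *)
pose u k := a k.+1.
have u_dec : {homo u : i j / (i <= j)%N >-> j <= i}.
  by apply/nonincreasing_seqP => k; have [] := step k.+1 isT (sigma_le k).
have u_lb : has_lbound (range u).
  by exists sigma1 => _ [k _ <-]; exact: sigma_le.
have := nonincreasing_cvgn u_dec u_lb; set L := inf _ => uL.
have sigmaL : sigma1 <= L.
  by apply: lb_le_inf; [exists (u 0%N), 0%N|move=> _ [k _ <-]; exact: sigma_le].
have lL := l_le _ sigmaL.
have uSL : u k.+1 @[k --> \oo] --> L by rewrite cvg_shiftS.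
(* The constant of [decrement_ge] for [b := u 0 ^+ 2], which bounds all later squares; it is
   positive since $n \geq 2$ gives [0 < m]. *)
pose c := (m%:R / (m.+2%:R * u 0%N ^+ 2)) ^+ m.
have c_gt0 : 0 < c.
  rewrite exprn_gt0 // divr_gt0 ?ltr0n // mulr_gt0 // exprn_gt0 //.
  exact: lt_le_trans (sigma_le 0%N).
have sqr_cvg (v : nat -> R) : v @ \oo --> L -> (fun k => v k ^+ 2) @ \oo --> L ^+ 2.
  move=> vL; rewrite expr2; under eq_fun do rewrite expr2.
  exact: cvgM.
have exp_cvg j : (fun k => (u k ^+ 2 - l) ^+ j) @ \oo --> (L ^+ 2 - l) ^+ j.
  elim: j => [|j IH].
    by rewrite expr0; under eq_fun do rewrite expr0; exact: cvg_cst.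
  rewrite exprS; under eq_fun do rewrite exprS.
  by apply: cvgM => //; apply: cvgB; [exact: sqr_cvg|exact: cvg_cst].
(* Limit of the lower bound on the decrements [u k ^+ 2 - u k.+1 ^+ 2], which tend to 0. *)
have gap_le0 : (L ^+ 2 - l) ^+ m.+1 * c <= 0.
  have lhs : (fun k => (u k ^+ 2 - l) ^+ m.+1 * c) @ \oo --> (L ^+ 2 - l) ^+ m.+1 * c.
    by apply: cvgM => //; exact: cvg_cst.
  have rhs : (fun k => u k ^+ 2 - u k.+1 ^+ 2) @ \oo --> L ^+ 2 - L ^+ 2.
    by apply: cvgB; apply: sqr_cvg.
  rewrite -[leRHS](subrr (L ^+ 2)).
  apply: (ler_cvg_to lhs rhs); apply: nearW => k.
  have [_ _ ->] := step k.+1 isT (sigma_le k).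
  rewrite subKr; apply: decrement_ge => //; first exact/l_le/sigma_le.
  rewrite lerXn2r ?nnegrE ?(le_trans (ltW sigma_gt0)) ?sigma_le //.
  exact: u_dec.
have LE : L = sigma1.
  (* The product is also nonnegative as $L \geq \sigma_1$, so it vanishes and $L^2 = l =
     \sigma_1^2$. *)
  have : (L ^+ 2 - l) ^+ m.+1 * c == 0.
    by rewrite eq_le gap_le0 mulr_ge0 ?(ltW c_gt0) ?exprn_ge0 ?subr_ge0.
  rewrite mulf_eq0 (gt_eqF c_gt0) orbF expf_eq0 subr_eq0 -sqr_sigma /=.
  by rewrite eqrXn2 ?(le_trans (ltW sigma_gt0)) // => /eqP.
by rewrite -LE -cvg_shiftS.
Qed.
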